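(* Let $p$ be an odd prime, $n$ a positive integer, and let $g,g'\in\mathbb{F}_{p^n}[x]$ be two Dembowski-Ostrom polynomials within the same extended-affine equivalence class. Let $Y'\in\mathcal{D}_{g'}\cap \mathrm{GL}(n,\mathbb{F}_p)$. Then there exist elements $A\in\mathrm{GL}(n,\mathbb{F}_p)$ and $Y\in\mathcal{D}_g\cap\mathrm{GL}(n,\mathbb{F}_p)$ such that $$\mathcal{D}_{g'}Y'^{-1}=A^{-1}\cdot(\mathcal{D}_gY^{-1})\cdot A .$$ More precisely, if the extended-affine equivalence is given by $g'(x)=L'(g(L(x)+u))+v+L''(x)+w \bmod (x^{p^n}-x)$ with linearized permutation polynomials $L,L'$, a linearized polynomial $L''$ in $\mathbb{F}_{p^n}[x]$, and $u,v,w\in\mathbb{F}_{p^n}$, and if $Y'=M_{g',\beta}$ with $\beta\in\mathbb{F}_{p^n}$, then one may take $Y=M_{g,L(\beta)}$ and $A=M_{L'}^{-1}$, where $M_{L'}$ is the matrix associated to $L'$.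
   Context: A Dembowski-Ostrom (DO) polynomial in $\mathbb{F}_{p^n}[x]$ is one of the form $\sum_{0\le i\le j\le n-1}u_{i,j}x^{p^i+p^j}$ with $u_{i,j}\in\mathbb{F}_{p^n}$. A linearized polynomial is one of the form $\sum_i u_ix^{p^i}$, $u_i\in\mathbb{F}_{p^n}$; it is a linearized permutation polynomial if its evaluation map on $\mathbb{F}_{p^n}$ is bijective. Fix an $\mathbb{F}_p$-basis of $\mathbb{F}_{p^n}$; then each linearized polynomial $L$ (inducing an $\mathbb{F}_p$-linear map of $\mathbb{F}_{p^n}$) is associated with the matrix $M_L\in\mathrm{Mat}_{\mathbb{F}_p}(n,n)$ of that map with respect to this basis (acting by left multiplication on column vectors). For a DO polynomial $g$ and $\alpha\in\mathbb{F}_{p^n}$, $\Delta_{g,\alpha}(x)=g(x+\alpha)-g(x)-g(\alpha)$ is a linearized polynomial; $M_{g,\alpha}$ denotes its associated matrix, and $\mathcal{D}_g=\{M_{g,\alpha}\mid\alpha\in\mathbb{F}_{p^n}\}$. For invertible $Y$, $\mathcal{D}_gY^{-1}=\{XY^{-1}\mid X\in\mathcal{D}_g\}$. Two polynomials $g,g'\in\mathbb{F}_{p^n}[x]/(x^{p^n}-x)$ are extended-affine equivalent if there exist linearized permutation polynomials $L,L'$, a linearized polynomial $L''$, and constants $u,v,w\in\mathbb{F}_{p^n}$ with $g'(x)=L'(g(L(x)+u))+v+L''(x)+w \bmod (x^{p^n}-x)$. *)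

(* Defs.v *)
From HB Require Import structures.
From mathcomp Require Import all_boot all_order all_algebra all_field.

Set Implicit Arguments.
Unset Strict Implicit.
Unset Printing Implicit Defensive.

Import GRing.Theory.
Local Open Scope ring_scope.

(* The field F_{p^n} is a field extension F of 'F_p with \dim {:F} = n. Since
   F itself is not canonically a finType, sets indexed by the elements of F
   range over the alias finvect_type F. *)

Section DembowskiOstrom.

Variables (p n : nat) (F : fieldExtType 'F_p).

Definition dembowski_ostrom (g : {poly F}) : Prop :=
  exists u : 'I_n -> 'I_n -> F,
    g = \sum_(i < n) \sum_(j < n | (i <= j)%N) u i j *: 'X^(p ^ i + p ^ j).

Definition linearized (L : {poly F}) : Prop :=
  exists (m : nat) (u : 'I_m -> F), L = \sum_(i < m) u i *: 'X^(p ^ i).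

Definition linearized_perm (L : {poly F}) : Prop :=
  linearized L /\ bijective (fun x : F => L.[x]).

(* The defining equation of extended-affine equivalence, as a congruence
   modulo x^(p^n) - x. *)
Definition ea_witness (g g' L L' L'' : {poly F}) (u v w : F) : Prop :=
  [/\ linearized_perm L, linearized_perm L', linearized L'' &
      g' %% ('X^(p ^ n) - 'X) =
      (L' \Po (g \Po (L + u%:P)) + v%:P + L'' + w%:P) %% ('X^(p ^ n) - 'X)].

Definition ea_equiv (g g' : {poly F}) : Prop :=
  exists (L L' L'' : {poly F}) (u v w : F), ea_witness g g' L L' L'' u v w.

Definition Delta (g : {poly F}) (a : F) : {poly F} :=
  g \Po ('X + a%:P) - g - g.[a]%:P.

(* Column convention: column j holds the coordinates of L(e_j), so that the
   matrix acts by left multiplication on column vectors. *)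
Definition lin_matrix (e : n.-tuple F) (L : {poly F}) : 'M['F_p]_n :=
  \matrix_(i, j) coord e i L.[e`_j].

Definition DO_matrix (e : n.-tuple F) (g : {poly F}) (a : F) : 'M['F_p]_n :=
  lin_matrix e (Delta g a).

Definition DO_set (e : n.-tuple F) (g : {poly F}) : {set 'M['F_p]_n} :=
  [set DO_matrix e g a | a : finvect_type F].

End DembowskiOstrom.

Definition set_mulV (K : finFieldType) (n : nat)
    (D : {set 'M[K]_n}) (Y : 'M[K]_n) : {set 'M[K]_n} :=
  [set X *m invmx Y | X in D].

Definition set_conj (K : finFieldType) (n : nat)
    (A : 'M[K]_n) (D : {set 'M[K]_n}) : {set 'M[K]_n} :=
  [set invmx A *m X *m A | X in D].

(* Main.v *)
(* Taking second differences of the extended-affine relation gives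
   Delta_{g',a}(x) = L'(Delta_{g,L(a)}(L(x))), that is
   M_{g',a} = M_{L'} M_{g,L(a)} M_L.  Hence M_L cancels in
   M_{g',a} M_{g',b}^-1, leaving a conjugation by M_{L'}, and L(a) runs over the
   whole field with a. *)

Require Import Defs.
From HB Require Import structures.
From mathcomp Require Import all_boot all_order all_algebra all_field.
From mathcomp Require Import ring.

Set Implicit Arguments.
Unset Strict Implicit.
Unset Printing Implicit Defensive.

Import GRing.Theory.
Local Open Scope ring_scope.

(** Every scalar of ['F_p] is a natural multiple of 1, so scaling is iterated addition. *)
Lemma Fp_scalable_of_additive (p : nat) (V W : lmodType 'F_p) (f : V -> W) :
  {morph f : x y / x + y} -> forall c, {morph f : x / c *: x}.
Proof.
move=> fD c x; rewrite -(natr_Zp c) !scaler_nat.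
have f0 : f 0 = 0 by apply: (addrI (f 0)); rewrite -fD !addr0.
by elim: (nat_of_ord c) => [|k IH]; rewrite ?mulr0n // !mulrS fD IH.
Qed.

Section LinearMatrix.

Variables (p n : nat) (F : fieldExtType 'F_p) (e : n.-tuple F).
Hypothesis e_basis : basis_of {:F} e.

(** Expand [M.[e_j]] in the basis and push [L] through the sum. [N] is tied to the composite by its
    values only, so that it can be [Delta g' a] itself. *)
Lemma lin_matrix_comp (L M N : {poly F}) :
    {morph (fun x => L.[x]) : x y / x + y} ->
    (forall x, N.[x] = L.[M.[x]]) ->
  lin_matrix e N = lin_matrix e L *m lin_matrix e M.
Proof.
move=> LD NE; have LZ := Fp_scalable_of_additive LD.
have L0 : L.[0] = 0 by apply: (addrI L.[0]); rewrite -LD !addr0.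
apply/matrixP=> i j; rewrite !mxE NE.
rewrite [M.[_]](coord_basis e_basis (memvf _)).
rewrite (big_morph (fun x => L.[x]) LD L0) linear_sum /=.
by apply: eq_bigr => k _; rewrite LZ linearZ !mxE mulrC.
Qed.

End LinearMatrix.

Section Evaluation.

Variables (p n : nat) (F : fieldExtType 'F_p).
Hypothesis p_prime : prime p.

Lemma expr_pX_additive (k : nat) :
  {morph (fun x : F => x ^+ (p ^ k)) : x y / x + y}.
Proof.
have charF : p \in [pchar F] by rewrite pchar_lalg pchar_Fp.
by move=> x y; rewrite exprDn_pchar // pnatX pnatE // charF.
Qed.

Lemma linearized_additive (L : {poly F}) :
  linearized L -> {morph (fun x => L.[x]) : x y / x + y}.
Proof.
case=> m [u ->] x y; rewrite !horner_sum -big_split /=.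
by apply: eq_bigr => i _; rewrite !hornerZ !hornerXn expr_pX_additive mulrDr.
Qed.

Lemma horner_Delta (g : {poly F}) (a x : F) :
  (Delta g a).[x] = g.[x + a] - g.[x] - g.[a].
Proof. by rewrite /Delta !hornerE horner_comp !hornerE. Qed.

(** Expanding each power of [x + a] by Frobenius, the pure terms in [x] and in [a] cancel; the mixed
    ones form the polarization of the quadratic map [g]. *)
Lemma horner_Delta_DO (u : 'I_n -> 'I_n -> F) (a x : F) :
  (Delta (\sum_(i < n) \sum_(j < n | (i <= j)%N)
            u i j *: 'X^(p ^ i + p ^ j)) a).[x] =
  \sum_(i < n) \sum_(j < n | (i <= j)%N)
    u i j * (x ^+ (p ^ i) * a ^+ (p ^ j) + a ^+ (p ^ i) * x ^+ (p ^ j)).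
Proof.
rewrite horner_Delta !horner_sum -!sumrB; apply: eq_bigr => i _.
rewrite !horner_sum -!sumrB; apply: eq_bigr => j _.
rewrite !hornerZ !hornerXn !exprD !expr_pX_additive -!mulrBr; congr (_ * _).
by ring.
Qed.

Lemma Delta_DO_additive (g : {poly F}) (a : F) : dembowski_ostrom n g ->
  {morph (fun x => (Delta g a).[x]) : x y / x + y}.
Proof.
case=> u -> x y; rewrite !horner_Delta_DO -big_split; apply: eq_bigr => i _ /=.
rewrite -big_split; apply: eq_bigr => j _ /=.
by rewrite !expr_pX_additive; ring.
Qed.

Lemma dembowski_ostrom0 (g : {poly F}) : dembowski_ostrom n g -> g.[0] = 0.
Proof.
case=> u ->; rewrite horner_sum big1 // => i _.
rewrite horner_sum big1 // => j _; rewrite hornerZ hornerXn.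
by rewrite exprD !expr0n !expn_eq0 !eqn0Ngt prime_gt0 //= !mulr0.
Qed.

(** [F] has [p ^ n] elements, so the modulus vanishes at every point and the congruence becomes an
    equality of values. *)
Lemma horner_modp_pX (f : {poly F}) (x : F) :
  \dim {:F} = n -> (f %% ('X^(p ^ n) - 'X)).[x] = f.[x].
Proof.
move=> dimF; have xq : x ^+ (p ^ n) = x.
  have := Fermat's_little_theorem {:F}%AS x.
  by rewrite memvf dimF card_Fp // => /esym/eqP.
by rewrite [in RHS](divp_eq f ('X^(p ^ n) - 'X)) !hornerE xq subrr mulr0 add0r.
Qed.

(* As g'.[0] = 0, Delta g' is a second difference of g'; it therefore ignores
   L'', v and w, while the translation by u changes g only by the additive map
   Delta g u and a constant. *)
Lemma Delta_ea (g g' L L' L'' : {poly F}) (u v w : F) :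
    \dim {:F} = n -> dembowski_ostrom n g -> dembowski_ostrom n g' ->
    ea_witness n g g' L L' L'' u v w ->
  forall a x, (Delta g' a).[x] = L'.[(Delta g L.[a]).[L.[x]]].
Proof.
move=> dimF DOg DOg' [[linL _] [linL' _] linL'' eq_gg'] a x.
have LD := linearized_additive linL.
have L'D := linearized_additive linL'.
have L''D := linearized_additive linL''.
have g'E y : g'.[y] = L'.[g.[L.[y] + u]] + L''.[y] + (v + w).
  rewrite -(horner_modp_pX g' y dimF) eq_gg' horner_modp_pX //.
  by rewrite !(hornerD, hornerC, horner_comp); ring.
have g_sum y z : g.[y + z] = (Delta g z).[y] + g.[y] + g.[z].
  by rewrite horner_Delta; ring.
have L0 : L.[0] = 0 by apply: (addrI L.[0]); rewrite -LD !addr0.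
have L''0 : L''.[0] = 0 by apply: (addrI L''.[0]); rewrite -L''D !addr0.
(* Evaluation at 0 determines the constant: [v + w = - L'.[g.[u]]]. *)
have /eqP := dembowski_ostrom0 DOg'.
rewrite g'E L0 L''0 addr0 add0r addrC addr_eq0 => /eqP vwE.
rewrite horner_Delta !g'E LD L''D vwE.
rewrite (g_sum (_ + _) u) (g_sum L.[x] u) (g_sum L.[a] u).
(* The values of [Delta g u] cancel by additivity, as do those of [g] at [L.[x]], [L.[a]] and
   [u]. *)
rewrite Delta_DO_additive // (g_sum L.[x]) !L'D.
by ring.
Qed.

End Evaluation.

Theorem theorem2 (p n : nat) (F : fieldExtType 'F_p) (e : n.-tuple F)
    (g g' : {poly F}) (p_prime : prime p) (p_odd : odd p) (n_gt0 : (0 < n)%N)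
    (dimF : \dim {:F} = n) (e_basis : basis_of {:F} e)
    (DOg : dembowski_ostrom n g) (DOg' : dembowski_ostrom n g') :
  (ea_equiv n g g' ->
   forall Y' : 'M['F_p]_n, Y' \in DO_set e g' -> Y' \in unitmx ->
   exists A Y : 'M['F_p]_n,
     [/\ A \in unitmx, Y \in DO_set e g, Y \in unitmx &
         set_mulV (DO_set e g') Y' = set_conj A (set_mulV (DO_set e g) Y)])
  /\
  (forall (L L' L'' : {poly F}) (u v w : F),
   ea_witness n g g' L L' L'' u v w ->
   forall b : F, DO_matrix e g' b \in unitmx ->
   let Y := DO_matrix e g L.[b] in
   let A := invmx (lin_matrix e L') in
     [/\ lin_matrix e L' \in unitmx, A \in unitmx, Y \in DO_set e g,
         Y \in unitmx &
         set_mulV (DO_set e g') (DO_matrix e g' b) =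
         set_conj A (set_mulV (DO_set e g) Y)]).
Proof.
have main L L' L'' u v w (ea : ea_witness n g g' L L' L'' u v w) (b : F) :
    DO_matrix e g' b \in unitmx ->
  [/\ lin_matrix e L' \in unitmx, DO_matrix e g L.[b] \in unitmx &
      set_mulV (DO_set e g') (DO_matrix e g' b) =
      set_conj (invmx (lin_matrix e L'))
        (set_mulV (DO_set e g) (DO_matrix e g L.[b]))].
  have [[_ [Linv _ LinvK]] [linL' _] _ _] := ea.
  have L'D := linearized_additive p_prime linL'.
  have DME a : DO_matrix e g' a =
      lin_matrix e L' *m DO_matrix e g L.[a] *m lin_matrix e L.
    rewrite -mulmxA.
    rewrite -(@lin_matrix_comp _ _ _ _ e_basis _ _ (Delta g L.[a] \Po L)).
    - apply: (lin_matrix_comp e_basis L'D) => x.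
      by rewrite horner_comp (Delta_ea p_prime dimF DOg DOg' ea).
    - exact: (Delta_DO_additive p_prime _ DOg).
    - by move=> x; rewrite horner_comp.
  (* Invertibility of the product of square matrices passes to all three factors. *)
  rewrite DME !unitmx_mul => /andP[/andP[uL' uY] uL]; split=> //.
  have conjE a : DO_matrix e g' a *m
        invmx (lin_matrix e L' *m DO_matrix e g L.[b] *m lin_matrix e L) =
      lin_matrix e L' *m (DO_matrix e g L.[a] *m invmx (DO_matrix e g L.[b]))
        *m invmx (lin_matrix e L').
    (* Multiply the right side by the matrix of [Delta g' b] and then by its inverse; the inverses
       of the factors [L'] and [Delta g L.[b]] cancel in turn. *)
    rewrite DME; rewrite -[RHS](mulmxK (_ : lin_matrix e L' *m
      DO_matrix e g L.[b] *m lin_matrix e L \in unitmx)) ?unitmx_mul ?uL' ?uY //.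
    by rewrite !mulmxA !mulmxKV.
  rewrite /set_mulV /set_conj /DO_set -!imset_comp.
  apply/setP=> X; apply/imsetP/imsetP=> -[a _ ->] /=.
    by exists L.[a]; rewrite //= invmxK conjE.
  (* Surjectivity of [L] gives this inclusion: [a] is the image of [Linv a]. *)
  by exists (Linv a); rewrite //= invmxK conjE LinvK.
split=> [[L [L' [L'' [u [v [w ea]]]]]] _ /imsetP[b _ ->] uY' |
         L L' L'' u v w ea b uY' Y A].
  have [uL' uY eqD] := main _ _ _ _ _ _ ea b uY'.
  exists (invmx (lin_matrix e L')), (DO_matrix e g L.[b]).
  by split; rewrite ?unitmx_inv // imset_f.
have [uL' uY eqD] := main _ _ _ _ _ _ ea b uY'.
by split; rewrite ?unitmx_inv // imset_f.
Qed.
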